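(* Assume that the unconstrained problem $\max_{\pi\in\Pi^{\rm m}}J(\pi)$ has a unique optimal Markov policy, denoted by $\pi^{{\rm u}\ast}$. Let $\hat\pi^\ast$ be the optimal Markov policy for the constrained problem of maximizing $J(\hat\pi)$ over $\hat\pi\in\hat\Pi^{\rm m}$ subject to $\mathbb{P}^{\hat\pi}(\phi_T=1)\le\Delta$, where $\Delta\ge0$ is a given constant. Then, for $t=0,\ldots,T-1$, $$\hat\pi^\ast_t(\cdot\,|x_t,1)=\pi^{{\rm u}\ast}_t(\cdot\,|x_t)\quad\text{for all } x_t\in\mathcal{X}.$$
   Context: Original system. Consider the discrete-time nonlinear stochastic system $x_{t+1}=f(x_t,a_t,w_t)$, $t=0,1,\ldots$, with $f:\mathcal{X}\times\mathcal{A}\times\mathcal{W}\to\mathcal{X}$, where $x_t\in\mathcal{X}\subset\mathbb{R}^n$ is the state, $a_t\in\mathcal{A}\subset\mathbb{R}^m$ is the attack signal, and $w_t\in\mathcal{W}\subset\mathbb{R}^\ell$ is an independent random process noise. The initial state $x_0$ has distribution $p_0$. An alarm is triggered when the state reaches the alarm region $\mathcal{X}_{\rm a}\subset\mathcal{X}$. The attack begins at $t=0$ and ends at $t=T-1$. $\Pi^{\rm m}$ is the set of Markov policies of the original system, i.e. tuples $\pi=(\pi_t)_{t=0}^{T-1}$ of stochastic kernels $\pi_t(da_t|x_t)$ on $\mathcal{A}$ given $\mathcal{X}$. Augmented system. The augmented state is $(x_t,\phi_t)\in\mathcal{X}\times\{0,1\}$, where $\phi_t$ is called the alarm flag. It evolves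 by $x_{t+1}=f(x_t,a_t,w_t)$ and $\phi_{t+1}=1$ if $x_{t+1}\in\mathcal{X}_{\rm a}$ or $\phi_t=1$, and $\phi_{t+1}=0$ otherwise; initially $\phi_0=1$ if $x_0\in\mathcal{X}_{\rm a}$ and $\phi_0=0$ otherwise. $\hat\Pi^{\rm m}$ is the set of Markov policies of the augmented system, i.e. tuples $\hat\pi=(\hat\pi_t)_{t=0}^{T-1}$ of stochastic kernels $\hat\pi_t(da_t|x_t,\phi_t)$ on $\mathcal{A}$ given $\mathcal{X}\times\{0,1\}$. Objective. For a policy $\pi$ of either system, $\mathbb{P}^\pi$ denotes the probability measure it induces on the trajectories up to time $T$, $\mathbb{E}^\pi$ the corresponding expectation, and $J(\pi)=\mathbb{E}^\pi\big[\sum_{t=0}^{T-1}g_t(x_t,a_t)+g_T(x_T)\big]$ with given functions $g_0,\ldots,g_{T-1}$ on $\mathcal{X}\times\mathcal{A}$ and $g_T$ on $\mathcal{X}$.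
   Formalization: ''For all x_t'' fails at unreached (x_t,1); proved: equality a.s. on {φ_t=1} for any optimal constrained policy, and off sets no policy reaches if it is unique; policies are identified up to states no policy reaches; each g_t and g_T is assumed integrable under every policy. *)

(* Defs.v *)
From HB Require Import structures.
From mathcomp Require Import all_boot all_order all_algebra.
From mathcomp Require Import all_classical all_reals all_analysis.
From mathcomp Require Import measurable_realfun giry.

Set Implicit Arguments.
Unset Strict Implicit.
Unset Printing Implicit Defensive.

Import Order.TTheory GRing.Theory Num.Theory.
Import numFieldNormedType.Exports.

Local Open Scope classical_set_scope.
Local Open Scope ring_scope.

(* A measurableType must be inhabited, hence the witness X0. *)
Definition inhabited_set (T : choiceType) (X : set T) (X0 : X !=set0) : Type := X.

Section inhabited_set_instances.
Context (T : choiceType) (X : set T) (X0 : X !=set0).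

HB.instance Definition _ := Choice.on (inhabited_set X0).
HB.instance Definition _ := isPointed.Build (inhabited_set X0)
  (SigSub (mem_set (svalP (cid X0))) : X).

End inhabited_set_instances.

(* The subset X of T with the trace sigma-algebra {X `&` B | B measurable}. For
   T := n.-tuple R, whose sigma-algebra is the Borel one of R^n, this is the
   Borel sigma-algebra of X. *)
Definition trace_space d (T : measurableType d) (X : set T) (X0 : X !=set0) :=
  g_sigma_algebra_preimageType (fun x : inhabited_set X0 => set_val (x : X)).

Section systems.
Context {R : realType} {dS dA dW : measure_display}.
Variables (S : measurableType dS) (A : measurableType dA)
  (W : measurableType dW).

(* x_{t+1} = dynamics (x_t, a_t, w_t), with w_t of law noise t. *)
Record system := System {
  dynamics : {mfun (S * A * W)%type >-> S} ;
  noise : nat -> probability W R ;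
  initial : probability S R }.

(* Over a horizon T only the kernels at times t < T matter. *)
Definition policy := nat -> R.-pker S ~> A.

(* ((x_0, a_0), ..., (x_{t-1}, a_{t-1})) and x_t *)
Local Notation history t := (t.-tuple (S * A)%type * S)%type.

Definition extend (Y : system) t (h : history t) (a : A) (w : W) :
    history t.+1 :=
  ([tuple of rcons h.1 (h.2, a)], dynamics Y (h.2, a, w)).

Lemma measurable_extend Y t : measurable_fun [set: history t * A * W]
  (fun z => extend Y z.1.1 z.1.2 z.2).
Proof.
have mx : measurable_fun [set: history t * A * W] (fun z => z.1.1.2).
  by apply: measurableT_comp => //; exact: measurableT_comp.
have ma : measurable_fun [set: history t * A * W] (fun z => z.1.2).
  exact: measurableT_comp.
apply: measurable_fun_pair => /=; last first.
  apply: measurableT_comp => //; apply: measurable_fun_pair => //.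
  exact: measurable_fun_pair.
apply/measurable_fun_tnthP => i.
have [it|ti] := ltnP i t.
  rewrite (_ : _ \o _ =
    (fun z : history t * A * W => tnth z.1.1.1 (Ordinal it))).
    apply: (@measurableT_comp _ _ _ _ _ _ (fun x => tnth x (Ordinal it))).
      exact: measurable_tnth.
    by apply: measurableT_comp => //; exact: measurableT_comp.
  apply/funext => z /=; rewrite (tnth_nth point) /= nth_rcons size_tuple it.
  by rewrite (tnth_nth point).
have {}ti : i = t :> nat by apply/eqP; rewrite eqn_leq ti -ltnS ltn_ord.
rewrite (_ : _ \o _ = (fun z : history t * A * W => (z.1.1.2, z.1.2))).
  exact: measurable_fun_pair.
apply/funext => z /=; rewrite (tnth_nth point) /= nth_rcons size_tuple.
by rewrite ti ltnn eqxx.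
Qed.

Section step.
Local Open Scope ereal_scope.
Variables (Y : system) (t : nat) (m : probability (history t) R)
  (k : R.-pker S ~> A).

(* a ~ k(. | x_t) given the history, then w ~ noise t independently of (h, a) *)
Definition step_law (U : set (history t.+1)) : \bar R :=
  \int[m]_h \int[k h.2]_a noise Y t [set w | U (extend Y h a w)].

Let kh (h : history t) : {measure set A -> \bar R} := k h.2.

Let measurable_kh U : measurable U -> measurable_fun [set: history t] (kh ^~ U).
Proof.
by move=> mU; apply: (@measurableT_comp _ _ _ _ _ _ (k ^~ U)) => //;
  exact: measurable_kernel.
Qed.

HB.instance Definition _ := isKernel.Build _ _ _ _ _ kh measurable_kh.

Let kh_prob h : kh h [set: A] = 1.
Proof. exact: prob_kernel. Qed.

HB.instance Definition _ := Kernel_isProbability.Build _ _ _ _ _ kh kh_prob.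

Let G (U : set (history t.+1)) (z : history t * A) :=
  noise Y t [set w | U (extend Y z.1 z.2 w)].

Let mpre (U : set (history t.+1)) (z : history t * A) : measurable U -> measurable [set w | U (extend Y z.1 z.2 w)].
Proof.
move=> mU.
have mf : measurable_fun [set: W] (fun w => extend Y z.1 z.2 w).
  apply: (measurableT_comp (@measurable_extend Y t)
    (_ : measurable_fun setT (fun w => (z, w)))).
  exact: measurable_pair1.
by rewrite -[X in measurable X]setTI; exact: mf.
Qed.

Let mG (U : set (history t.+1)) : measurable U -> measurable_fun [set: history t * A] (G U).
Proof.
move=> mU.
have mV := @measurable_extend Y t measurableT U mU.
rewrite setTI in mV.
have := @measurable_fun_xsection _ _ _ _ R (noise Y t) _ mV.
apply: eq_measurable_fun => z _ /=.
by congr (noise Y t _); apply/seteqP; split => w; rewrite /xsection/= inE.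
Qed.

Let mI (U : set (history t.+1)) : measurable U ->
  measurable_fun [set: history t] (fun h => \int[k h.2]_a G U (h, a)).
Proof.
move=> mU.
exact: (@measurable_fun_integral_sfinite_kernel _ _ _ _ R (G U) kh _ (mG mU)).
Qed.

Let step_law0 : step_law set0 = 0.
Proof.
rewrite /step_law integral0_eq// => h _; rewrite integral0_eq// => a _.
by rewrite (_ : [set _ | _] = set0) ?measure0//; apply/seteqP; split.
Qed.

Let step_law_ge0 U : 0 <= step_law U.
Proof. by apply: integral_ge0 => h _; exact: integral_ge0. Qed.

Let step_law_additive : semi_sigma_additive step_law.
Proof.
move=> F mF tF mUF.
have -> : step_law (\bigcup_n F n) = \sum_(0 <= i <oo) step_law (F i).
  rewrite /step_law.
  rewrite -(@integral_nneseries _ _ _ m setT measurableT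
    (fun n h => \int[k h.2]_a G (F n) (h, a)))//; last 2 first.
  - by move=> n; exact: mI.
  - by move=> n h _; exact: integral_ge0.
  apply: eq_integral => h _.
  rewrite -(@integral_nneseries _ _ _ (k h.2) setT measurableT
    (fun n a => G (F n) (h, a)))//; last first.
    move=> n; apply: (measurableT_comp (mG (mF n))
      (_ : measurable_fun setT (fun a : A => (h, a)))).
    exact: measurable_pair1.
  apply: eq_integral => a _.
  rewrite (_ : [set w | (\bigcup_n F n) (extend Y h a w)] =
     \bigcup_n [set w | F n (extend Y h a w)]); last first.
    by apply/seteqP; split => w [n] _ ?; exists n.
  have mpF n : measurable [set w | F n (extend Y h a w)].
    exact: (@mpre (F n) (h, a)).
  rewrite measure_semi_bigcup//; last exact: bigcup_measurable.
  apply/trivIsetP => i j _ _ ij.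
  move/trivIsetP : tF => /(_ i j Logic.I Logic.I ij) Fij.
  apply/seteqP; split => // w [/= Fi Fj].
  by have : (F i `&` F j) (extend Y h a w) by []; rewrite Fij.
by apply: is_cvg_nneseries => n _ _.
Qed.

HB.instance Definition _ := isMeasure.Build _ _ _ step_law
  step_law0 step_law_ge0 step_law_additive.

Let step_law1 : step_law [set: _] = 1.
Proof.
rewrite /step_law (_ : (fun h => _) = cst 1).
  by rewrite integral_cst// mul1e; exact: probability_setT.
apply/funext => h; rewrite (_ : (fun a => _) = cst 1).
  by rewrite integral_cst// mul1e; exact: prob_kernel.
by apply/funext => a; exact: (@probability_setT _ _ _ (noise Y t)).
Qed.

HB.instance Definition _ := Measure_isProbability.Build _ _ _ step_law step_law1.

End step.

Definition start (x : S) : history 0 := ([tuple], x).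

Let measurable_start : measurable_fun [set: S] start.
Proof. exact: measurable_pair1. Qed.

HB.instance Definition _ := isMeasurableFun.Build _ _ _ _ start measurable_start.

(* The law P^pi of the trajectory up to time t. *)
Fixpoint trajectory (Y : system) (pi : policy) t : probability (history t) R :=
  if t is t'.+1 then step_law Y (trajectory Y pi t') (pi t')
  else distribution (initial Y) start.

(* The law of x_t under P^pi. *)
Definition state_law (Y : system) (pi : policy) t : set S -> \bar R :=
  pushforward (trajectory Y pi t) snd.

Section objective.
Variables (Y : system) (T : nat) (g : nat -> S * A -> R) (gT : S -> R).

Definition reward (h : history T) : R :=
  \sum_(t < T) g t (tnth h.1 t) + gT h.2.

Definition J (pi : policy) : \bar R := 'E_(trajectory Y pi T)[reward].

Definition integrable_rewards (pi : policy) : Prop :=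
  (forall t : 'I_T, (trajectory Y pi T).-integrable setT
     (fun h => (g t (tnth h.1 t))%:E)) /\
  (trajectory Y pi T).-integrable setT (fun h => (gT h.2)%:E).

(* pi maximizes J over the policies satisfying C. *)
Definition optimal (C : policy -> Prop) (pi : policy) : Prop :=
  C pi /\ forall pi', C pi' -> (J pi' <= J pi)%E.

End objective.

(* P holds at every state at time t, except for states that no policy reaches. *)
Definition holds_where_reachable (Y : system) t (P : S -> Prop) : Prop :=
  forall pi, {ae state_law Y pi t, forall x, P x}.

(* P^pi, hence J, does not see the kernels at states that no policy reaches:
   policies are identified when they agree at all other states. Two kernels
   that agree at every x, in particular, are identified. *)
Definition same_policy (Y : system) (T : nat) (pi pi' : policy) : Prop :=
  forall t, (t < T)%N -> holds_where_reachable Y t (fun x => pi t x ≡μ pi' t x).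

Definition unique_optimal (Y : system) (T : nat) (g : nat -> S * A -> R)
    (gT : S -> R) (C : policy -> Prop) (pi : policy) : Prop :=
  optimal Y T g gT C pi /\
  forall pi', optimal Y T g gT C pi' -> same_policy Y T pi' pi.

End systems.

Section augmented.
Context {R : realType} {dX dA dW : measure_display}.
Context {X : measurableType dX} {A : measurableType dA} {W : measurableType dW}.
Variables (Y : @system R _ _ _ X A W) (Xa : set X) (mXa : measurable Xa).

Let measurable_inXa : measurable_fun [set: X] (fun x => `[< Xa x >]).
Proof.
apply: (measurable_fun_bool true); rewrite setTI.
rewrite (_ : _ @^-1` _ = Xa)//.
by apply/seteqP; split => x /=; [move/asboolP|move=> ?; apply/asboolP].
Qed.

(* true is the flag value 1 *)
Definition augmented_dynamics (z : X * bool * A * W) : X * bool :=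
  let: (x, phi, a, w) := z in
  let x' := dynamics Y (x, a, w) in (x', `[< Xa x' >] || phi).

Lemma measurable_augmented_dynamics :
  measurable_fun [set: X * bool * A * W] augmented_dynamics.
Proof.
have mx : measurable_fun [set: X * bool * A * W]
    (fun z => dynamics Y (z.1.1.1, z.1.2, z.2)).
  apply: measurableT_comp => //; apply: measurable_fun_pair => //.
  apply: measurable_fun_pair; last exact: measurableT_comp.
  by apply: measurableT_comp => //; exact: measurableT_comp.
rewrite (_ : augmented_dynamics = (fun z : X * bool * A * W =>
  (dynamics Y (z.1.1.1, z.1.2, z.2),
   `[< Xa (dynamics Y (z.1.1.1, z.1.2, z.2)) >] || z.1.1.2))); last first.
  by apply/funext => -[[[x b] a] w].
apply: measurable_fun_pair => //; apply: measurable_or.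
  exact: (measurableT_comp measurable_inXa mx).
by apply: measurableT_comp => //; exact: measurableT_comp.
Qed.

HB.instance Definition _ := isMeasurableFun.Build _ _ _ _ augmented_dynamics
  measurable_augmented_dynamics.

Definition augmented_start (x : X) : X * bool := (x, `[< Xa x >]).

Let measurable_augmented_start : measurable_fun [set: X] augmented_start.
Proof. exact: measurable_fun_pair. Qed.

HB.instance Definition _ := isMeasurableFun.Build _ _ _ _ augmented_start
  measurable_augmented_start.

Definition augmented : @system R _ _ _ (X * bool)%type A W :=
  System augmented_dynamics (noise Y) (distribution (initial Y) augmented_start).

(* P^pi (phi_T = 1) *)
Definition alarm_probability (T : nat) (pi : policy (X * bool)%type A) : \bar R :=
  state_law augmented pi T [set z | z.2 = true].

End augmented.

(* Main.v *)
Require Import Defs.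
From HB Require Import structures.
From mathcomp Require Import all_boot all_order all_algebra.
From mathcomp Require Import all_classical all_reals all_analysis.
From mathcomp Require Import measurable_realfun giry.
From mathcomp Require Import ring.
Import Order.TTheory GRing.Theory Num.Theory.
Import numFieldNormedType.Exports.
Local Open Scope classical_set_scope.
Local Open Scope ring_scope.

(* Let rho be the policy of the augmented system that follows pihat until the
   alarm and piu afterwards. The flag is absorbing, so rho has the same alarm
   probability as pihat, and its value at a flagged state is the value of piu.
   By the performance difference formula, J rho - J pihat is the sum over t of
   the expected one-stage advantage of piu over pihat at flagged states.

   That advantage is nonnegative, and zero only where the kernels agree, at
   almost every state reachable in the original system: replacing piu at time t
   by pihat(.|., 1) on the set where the latter does at least as well gives an
   optimal policy, hence by uniqueness the same policy. This uses uniqueness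
   also to control states that piu itself does not reach. The law of x_t under
   pihat is at most 2^t times its law under the policy of the original system
   that flips a fair coin between pihat(.|x, 0) and pihat(.|x, 1), so negligible
   sets of the original system are negligible in the augmented one.

   Rewards are signed; their positive and negative parts are treated as two
   nonnegative reward structures, so that every exchange of integrals is
   Tonelli's. *)

(** * Kernels and integrals *)

Section kernel_operations.
Local Open Scope ereal_scope.
Context {R : realType} {d d' : measure_display}
  {X : measurableType d} {Y : measurableType d'}.

Section reindex.
Context {d0 : measure_display} {X0 : measurableType d0}.
Variables (f : X0 -> X) (mf : measurable_fun [set: X0] f) (k : R.-pker X ~> Y).

(** The measurability proof is part of the term, so that the kernel structure can be inferred from
    the term alone. *)
Definition kreindex of measurable_fun [set: X0] f :
  X0 -> {measure set Y -> \bar R} := fun x => k (f x).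

Let measurable_kreindex U : measurable U ->
  measurable_fun [set: X0] (kreindex mf ^~ U).
Proof.
by move=> mU; exact: (measurableT_comp (measurable_kernel k U mU) mf).
Qed.

HB.instance Definition _ :=
  isKernel.Build _ _ _ _ _ (kreindex mf) measurable_kreindex.

Let kreindex_prob x : kreindex mf x [set: Y] = 1.
Proof. exact: prob_kernel. Qed.

HB.instance Definition _ :=
  Kernel_isProbability.Build _ _ _ _ _ (kreindex mf) kreindex_prob.

End reindex.

Section choice_kernel.
Variables (b : X -> bool) (mb : measurable_fun [set: X] b).
Variables k1 k2 : R.-pker X ~> Y.

Definition kif of measurable_fun [set: X] b :
  X -> {measure set Y -> \bar R} := fun x => if b x then k1 x else k2 x.

Let measurable_kif U : measurable U -> measurable_fun [set: X] (kif mb ^~ U).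
Proof.
move=> mU; rewrite [X in measurable_fun _ X](_ : _ =
  fun x => if b x then k1 x U else k2 x U).
  by apply: measurable_fun_ifT => //;
    [exact: (measurable_kernel k1)|exact: (measurable_kernel k2)].
by apply/funext => x; rewrite /kif; case: ifP.
Qed.

HB.instance Definition _ := isKernel.Build _ _ _ _ _ (kif mb) measurable_kif.

Let kif_prob x : kif mb x [set: Y] = 1.
Proof. by rewrite /kif; case: ifP => _; exact: prob_kernel. Qed.

HB.instance Definition _ :=
  Kernel_isProbability.Build _ _ _ _ _ (kif mb) kif_prob.

End choice_kernel.

Section mixture_kernel.
Variables k1 k2 : R.-pker X ~> Y.

Let half : {nonneg R}%R := ((2^-1)%:nng)%R.

Definition kmix : X -> {measure set Y -> \bar R} :=
  fun x => mscale half (measure_add (k1 x) (k2 x)).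

Let kmixE x U : kmix x U = (2^-1)%:E * (k1 x U + k2 x U).
Proof.
by rewrite -[LHS]/((2^-1)%:E * measure_add (k1 x) (k2 x) U) measure_addE.
Qed.

Let measurable_kmix U : measurable U -> measurable_fun [set: X] (kmix ^~ U).
Proof.
move=> mU; rewrite [X in measurable_fun _ X](_ : _ =
  fun x => (2^-1)%:E * (k1 x U + k2 x U)).
  by apply: measurable_funeM; apply: emeasurable_funD;
    [exact: (measurable_kernel k1)|exact: (measurable_kernel k2)].
by apply/funext => x; rewrite kmixE.
Qed.

HB.instance Definition _ := isKernel.Build _ _ _ _ _ kmix measurable_kmix.

Let kmix_prob x : kmix x [set: Y] = 1.
Proof.
by rewrite kmixE !prob_kernel -EFinD -EFinM (_ : (1 + 1 = 2)%R)// mulVf.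
Qed.

HB.instance Definition _ := Kernel_isProbability.Build _ _ _ _ _ kmix kmix_prob.

Lemma ge0_integral_kmix x F :
  measurable_fun [set: Y] F -> (forall y, 0 <= F y) ->
  \int[kmix x]_y F y = (2^-1)%:E * (\int[k1 x]_y F y + \int[k2 x]_y F y).
Proof.
by move=> mF F0; rewrite ge0_integral_mscale// ge0_integral_measure_add.
Qed.

End mixture_kernel.

End kernel_operations.

(** * Mixtures of measures and the equality case of integral comparisons *)

Section integral_lemmas.
Local Open Scope ereal_scope.
Context {R : realType}.

Lemma lee_fineD2 (a b c e : \bar R) : a \is a fin_num -> b \is a fin_num ->
  c \is a fin_num -> e \is a fin_num ->
  (a + b <= c + e) = (fine a + fine b <= fine c + fine e)%R.
Proof.
by case: a => [a| |]//; case: b => [b| |]//; case: c => [c| |]//;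
  case: e => [e| |]//= *; rewrite -!EFinD lee_fin.
Qed.

Lemma integral_cst_mass1 {d} {X : measurableType d}
    (mu : {measure set X -> \bar R}) (c : \bar R) :
  mu [set: X] = 1 -> \int[mu]_x c = c.
Proof. by move=> mu1; rewrite integral_cst// mu1 mule1. Qed.

Section mixture.
Context {d d' : measure_display} {X : measurableType d} {Z : measurableType d'}.
Variables (mu : {measure set Z -> \bar R}) (nu : {measure set X -> \bar R})
  (k : X -> {measure set Z -> \bar R}).
Hypothesis mk : forall U, measurable U -> measurable_fun [set: X] (k ^~ U).
Hypothesis muE : forall U, measurable U -> mu U = \int[nu]_x k x U.

Import HBNNSimple.

(** Simple functions increasing to [F] reduce the identity to measurable sets, where it is the
    hypothesis [muE]; monotone convergence is used under each of the three integrals. *)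
Lemma ge0_integral_mixture F :
  measurable_fun [set: Z] F -> (forall z, 0 <= F z) ->
  \int[mu]_z F z = \int[nu]_x \int[k x]_z F z.
Proof.
move=> mF F0; pose F_ := nnsfun_approx measurableT mF.
have mF_ n : measurable_fun [set: Z] (fun z => (F_ n z)%:E).
  exact/measurable_EFinP.
have F_0 n z : 0 <= (F_ n z)%:E by rewrite lee_fin.
have ndF_ z : [set: Z] z ->
    {homo (fun n => (F_ n z)%:E) : m n / (m <= n)%N >-> m <= n}.
  by move=> _ m n mn; rewrite lee_fin; exact/lefP/nd_nnsfun_approx.
have limF_ z : F z = limn (fun n => (F_ n z)%:E).
  by apply/esym/cvg_lim => //; exact: cvg_nnsfun_approx.
have ikE x : \int[k x]_z F z = limn (fun n => \int[k x]_z (F_ n z)%:E).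
  by rewrite -monotone_convergence//; apply: eq_integral.
have simple n : \int[mu]_z (F_ n z)%:E = \int[nu]_x \int[k x]_z (F_ n z)%:E.
  rewrite integralT_nnsfun sintegralE.
  under [RHS]eq_integral do rewrite integralT_nnsfun sintegralE.
  rewrite ge0_integral_fsum//; last 2 first.
  - by move=> r; apply: measurable_funeM; exact: mk.
  - by move=> r x _; exact: nnsfun_mulemu_ge0.
  apply: eq_fsbigr => r _; rewrite muE//.
  have [r0|r0] := leP 0%R r; first by rewrite ge0_integralZl//; exact: mk.
  (* A negative [r] has empty preimage under a nonnegative function, so both sides vanish. *)
  rewrite integral0_eq ?mule0; last first.
    by move=> x _; rewrite preimage_nnfun0.
  by rewrite integral0_eq// => x _; rewrite preimage_nnfun0// measure0 mule0.
under eq_integral do rewrite limF_.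
rewrite monotone_convergence//.
under [RHS]eq_integral do rewrite ikE.
rewrite monotone_convergence//; last 3 first.
- by move=> n; apply: measurable_fun_integral_kernel.
- by move=> n x _; exact: integral_ge0.
- move=> x _ m n mn; apply: ge0_le_integral => // z _; exact: ndF_.
by congr (limn _); apply/funext => n; exact: simple.
Qed.

End mixture.

(** The difference [g - f] is nonnegative almost everywhere and has zero integral, so it vanishes
    almost everywhere. Finiteness of the integral of [f] allows the subtraction. *)
Lemma ge0_le_integral_ae_ge {d} {X : measurableType d}
    (mu : {measure set X -> \bar R}) (f g : X -> \bar R) :
  measurable_fun [set: X] f -> measurable_fun [set: X] g ->
  (forall x, 0 <= f x) -> (forall x, 0 <= g x) ->
  {ae mu, forall x, f x <= g x} ->
  \int[mu]_x g x <= \int[mu]_x f x -> \int[mu]_x f x < +oo ->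
  {ae mu, forall x, g x <= f x}.
Proof.
move=> mf mg f0 g0 fg gf foo.
have intf : mu.-integrable setT f.
  by apply/integrableP; split => //; under eq_integral do rewrite gee0_abs//.
have intg : mu.-integrable setT g.
  apply/integrableP; split => //; under eq_integral do rewrite gee0_abs//.
  exact: le_lt_trans foo.
have intfE : \int[mu]_x g x = \int[mu]_x f x.
  apply/eqP; rewrite eq_le gf/= ae_ge0_le_integral//.
  by apply: filterS fg.
have mh : measurable_fun setT (g \- f) by exact: emeasurable_funB.
have int0 : \int[mu]_x `|(g \- f) x| = 0.
  transitivity (\int[mu]_x (g \- f) x).
    apply: ae_eq_integral => //; first exact: measurableT_comp.
    have fin := integrable_ae measurableT intf.
    apply: filterS2 fg fin => x fgx /(_ Logic.I) fx _.
    by rewrite gee0_abs// sube_ge0// fx.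
  rewrite integralB// intfE subee//.
  by rewrite ge0_fin_numE// integral_ge0.
have /ae_eq_integral_abs : \int[mu]_x `|(g \- f) x| = 0 by [].
move=> /(_ measurableT mh).
have fin := integrable_ae measurableT intf.
apply: filterS2 fin => x /(_ Logic.I) fx /(_ Logic.I) /= gfx0.
by rewrite -sube_le0 ?gfx0.
Qed.

(** The stage comparisons weigh [p] against [q] in this form: sums on both sides instead of
    differences of extended reals. The second conclusion is the equality case. *)
Lemma ae_le_integralD2 {d} {X : measurableType d}
    (mu : {measure set X -> \bar R}) (a b c e : X -> \bar R) :
  measurable_fun [set: X] a -> measurable_fun [set: X] b ->
  measurable_fun [set: X] c -> measurable_fun [set: X] e ->
  (forall x, 0 <= a x) -> (forall x, 0 <= b x) ->
  (forall x, 0 <= c x) -> (forall x, 0 <= e x) ->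
  \int[mu]_x a x \is a fin_num -> \int[mu]_x b x \is a fin_num ->
  \int[mu]_x c x \is a fin_num -> \int[mu]_x e x \is a fin_num ->
  {ae mu, forall x, a x + b x <= c x + e x} ->
  let I f := fine (\int[mu]_x f x) in
  (I a + I b <= I c + I e)%R /\
  ((I c + I e <= I a + I b)%R -> {ae mu, forall x, c x + e x <= a x + b x}).
Proof.
move=> ma mb mc me a0 b0 c0 e0 fa fb fc fe le_ae I.
have mab : measurable_fun [set: X] (a \+ b) by exact: emeasurable_funD.
have mce : measurable_fun [set: X] (c \+ e) by exact: emeasurable_funD.
have ab0 x : 0 <= a x + b x by exact: adde_ge0.
have ce0 x : 0 <= c x + e x by exact: adde_ge0.
split.
  rewrite -lee_fineD2// -!ge0_integralD//.
  by apply: ae_ge0_le_integral => //; apply: filterS le_ae.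
move=> ge_int; apply: ge0_le_integral_ae_ge => //.
  by rewrite !ge0_integralD// lee_fineD2.
by rewrite ge0_integralD// ltey_eq fin_numD fa fb.
Qed.

End integral_lemmas.

(** * State laws and value functions *)

Section trajectory_integrals.
Local Open Scope ereal_scope.
Context {R : realType} {dS dA dW : measure_display} {S : measurableType dS}
  {A : measurableType dA} {W : measurableType dW}.
Variable Y : @system R _ _ _ S A W.

Local Notation history t := (t.-tuple (S * A)%type * S)%type.

Section step.
Variable t : nat.

Let step (z : history t * A) (w : W) : history t.+1 := extend Y z.1 z.2 w.

Let measurable_step z : measurable_fun [set: W] (step z).
Proof.
have mz : measurable_fun [set: W] (fun w => (z, w)) by exact: measurable_pair1.
exact: measurableT_comp (@measurable_extend _ _ _ _ _ _ _ Y t) mz.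
Qed.

HB.instance Definition _ z :=
  isMeasurableFun.Build _ _ _ _ (step z) (measurable_step z).

Let step_kernel (z : history t * A) : {measure set (history t.+1) -> \bar R} :=
  distribution (noise Y t) (step z).

Let measurable_step_kernel U : measurable U ->
  measurable_fun [set: history t * A] (step_kernel ^~ U).
Proof.
move=> mU; have mV := @measurable_extend _ _ _ _ _ _ _ Y t measurableT U mU.
rewrite setTI in mV.
have := measurable_fun_xsection (noise Y t) mV.
apply: eq_measurable_fun => z _ /=.
by congr (noise Y t _); apply/seteqP; split => w; rewrite /xsection/= inE.
Qed.

HB.instance Definition _ :=
  isKernel.Build _ _ _ _ _ step_kernel measurable_step_kernel.

Let step_kernel_prob z : step_kernel z [set: history t.+1] = 1.
Proof. exact: probability_setT. Qed.

HB.instance Definition _ :=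
  Kernel_isProbability.Build _ _ _ _ _ step_kernel step_kernel_prob.

(** On sets, [step_law] is the composition of the action kernel [l] and [step_kernel]; the mixture
    lemma extends this to integrands. *)
Lemma integral_trajectoryS (pi : policy S A) (F : history t.+1 -> \bar R) :
  measurable_fun [set: history t.+1] F -> (forall h, 0 <= F h) ->
  \int[trajectory Y pi t.+1]_h F h =
  \int[trajectory Y pi t]_h \int[pi t h.2]_a \int[noise Y t]_w
    F (extend Y h a w).
Proof.
move=> mF F0.
have m2 : measurable_fun [set: history t] (snd : history t -> S) by [].
pose l : R.-pker (history t) ~> A := kreindex (snd : history t -> S) (pi t) m2.
pose k : R.-pker (history t * A) ~> (history t.+1) := step_kernel.
rewrite (ge0_integral_mixture (trajectory Y pi t.+1) (trajectory Y pi t)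
  (mkcomp l k))//.
- apply: eq_integral => h _; rewrite [LHS]integral_kcomp//.
  apply: eq_integral => a _.
  by rewrite [LHS]ge0_integral_distribution.
- by move=> U mU; exact: (measurable_kernel (mkcomp l k)).
Qed.

End step.

Definition last_state t (h : history t) : S := h.2.

Let measurable_last_state t : measurable_fun [set: history t] (@last_state t).
Proof. exact: measurable_snd. Qed.

HB.instance Definition _ t :=
  isMeasurableFun.Build _ _ _ _ (@last_state t) (@measurable_last_state t).

(** The same set function as [state_law], packaged as a probability measure. *)
Definition law (pi : policy S A) t : probability S R :=
  distribution (trajectory Y pi t) (@last_state t).

Definition mean_next t (F : S -> \bar R) (z : S * A) : \bar R :=
  \int[noise Y t]_w F (dynamics Y (z, w)).

Definition mean_action (k : R.-pker S ~> A) (G : S * A -> \bar R) (x : S) :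
  \bar R := \int[k x]_a G (x, a).

Lemma mean_next_ge0 t F z : (forall x, 0 <= F x) -> 0 <= mean_next t F z.
Proof. by move=> F0; exact: integral_ge0. Qed.

Lemma mean_action_ge0 k G x : (forall z, 0 <= G z) -> 0 <= mean_action k G x.
Proof. by move=> G0; exact: integral_ge0. Qed.

Lemma measurable_mean_next t F : measurable_fun [set: S] F ->
  (forall x, 0 <= F x) -> measurable_fun [set: S * A] (mean_next t F).
Proof.
move=> mF F0.
apply: (@measurable_fun_fubini_tonelli_F _ _ _ _ _ (noise Y t)
  (fun z => F (dynamics Y z))) => //; exact: measurableT_comp.
Qed.

Lemma measurable_mean_action k G : measurable_fun [set: S * A] G ->
  (forall z, 0 <= G z) -> measurable_fun [set: S] (mean_action k G).
Proof.
by move=> mG G0; exact: (measurable_fun_integral_sfinite_kernel G k G0 mG).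
Qed.

Lemma integral_law pi t F : measurable_fun [set: S] F -> (forall x, 0 <= F x) ->
  \int[law pi t]_x F x = \int[trajectory Y pi t]_h F h.2.
Proof. by move=> mF F0; rewrite ge0_integral_distribution. Qed.

Lemma integral_law0 pi F : measurable_fun [set: S] F -> (forall x, 0 <= F x) ->
  \int[law pi 0%N]_x F x = \int[initial Y]_x F x.
Proof.
by move=> mF F0; rewrite integral_law// ge0_integral_distribution.
Qed.

Lemma integral_lawS pi t F : measurable_fun [set: S] F -> (forall x, 0 <= F x) ->
  \int[law pi t.+1]_x F x =
  \int[law pi t]_x mean_action (pi t) (mean_next t F) x.
Proof.
move=> mF F0; rewrite integral_law// integral_trajectoryS//; last first.
  exact: measurableT_comp.
rewrite integral_law//.
- by apply: measurable_mean_action; [exact: measurable_mean_next|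
    move=> z; exact: mean_next_ge0].
- by move=> x; apply: mean_action_ge0 => z; exact: mean_next_ge0.
Qed.

(** Later steps leave the recorded pair alone and have total mass 1, so everything after time [s]
    integrates out. *)
Lemma integral_trajectory_step pi t (s : 'I_t) (G : S * A -> \bar R) :
  measurable_fun [set: S * A] G -> (forall z, 0 <= G z) ->
  \int[trajectory Y pi t]_h G (tnth h.1 s) =
  \int[law pi s]_x mean_action (pi s) G x.
Proof.
move=> mG G0; elim: t s => [[]//|t IH] s.
rewrite integral_trajectoryS//; last first.
  apply: (measurableT_comp mG).
  by apply: (measurableT_comp (measurable_tnth s)).
(* [unlift ord_max s] separates an index already present in [h] from the last one, which holds the
   appended pair. *)
have tnthE h a w : tnth (extend Y h a w).1 s =
    if unlift ord_max s is Some s' then tnth h.1 s' else (h.2, a).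
  rewrite (tnth_nth point)/= nth_rcons size_tuple.
  case: unliftP => [s' ->|->].
    by rewrite lift_max ltn_ord (tnth_nth point).
  by rewrite ltnn eqxx.
under eq_integral do under eq_integral do under eq_integral do rewrite tnthE.
case: unliftP => [s' ->|->].
  rewrite lift_max -IH; apply: eq_integral => h _.
  transitivity (\int[pi t h.2]_a G (tnth h.1 s')).
    apply: eq_integral => a _; apply: integral_cst_mass1.
    exact: probability_setT.
  apply: integral_cst_mass1; exact: prob_kernel.
transitivity (\int[trajectory Y pi t]_h mean_action (pi t) G h.2).
  apply: eq_integral => h _; apply: eq_integral => a _.
  apply: integral_cst_mass1; exact: probability_setT.
rewrite integral_law//; last by move=> x; exact: mean_action_ge0.
exact: measurable_mean_action.
Qed.

End trajectory_integrals.

(** * Value functions and the performance difference formula *)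

Section values.
Local Open Scope ereal_scope.
Context {R : realType} {dS dA dW : measure_display} {S : measurableType dS}
  {A : measurableType dA} {W : measurableType dW}.

Record nonneg_rewards := NonnegRewards {
  running : nat -> S * A -> \bar R ;
  final : S -> \bar R ;
  measurable_running : forall t, measurable_fun [set: S * A] (running t) ;
  measurable_final : measurable_fun [set: S] final ;
  running_ge0 : forall t z, 0 <= running t z ;
  final_ge0 : forall x, 0 <= final x }.

Variables (Y : @system R _ _ _ S A W) (T : nat).
Implicit Types (r : nonneg_rewards) (pi rho : @policy R _ _ S A).

Lemma law_eq pi rho s : (forall i, (i < s)%N -> pi i = rho i) ->
  law Y pi s = law Y rho s.
Proof.
move=> pirho; rewrite /law.
suff -> : trajectory Y pi s = trajectory Y rho s by [].
elim: s pirho => //= s IH pirho; rewrite IH => [|i si].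
  by rewrite pirho.
by apply: pirho; exact: ltnW.
Qed.

(** The Bellman operator of the kernel [k] at time [t], applied to the continuation value [F]. *)
Definition stage_value r (k : R.-pker S ~> A) t (F : S -> \bar R) : S -> \bar R :=
  mean_action k (fun z => running r t z + mean_next Y t F z).

(* The expected reward from time t on under rho, with j steps to go. *)
Fixpoint value r rho j t : S -> \bar R :=
  if j is j'.+1 then stage_value r (rho t) t (value r rho j' t.+1) else final r.

Definition stage_reward r pi s : \bar R :=
  \int[law Y pi s]_x mean_action (pi s) (running r s) x.

Definition total_reward r pi : \bar R :=
  \sum_(i < T) stage_reward r pi i + \int[law Y pi T]_x final r x.

(* The total reward of the policy that follows pi before time s and rho from
   time s on. *)
Definition hybrid r pi rho s : \bar R :=
  \sum_(i < s) stage_reward r pi i +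
  \int[law Y pi s]_x value r rho (T - s) s x.

Lemma stage_value_ge0 r k t F x : (forall y, 0 <= F y) ->
  0 <= stage_value r k t F x.
Proof.
move=> F0; apply: mean_action_ge0 => z; apply: adde_ge0.
  exact: running_ge0.
exact: mean_next_ge0.
Qed.

Lemma measurable_stage_value r k t F : measurable_fun [set: S] F ->
  (forall y, 0 <= F y) -> measurable_fun [set: S] (stage_value r k t F).
Proof.
move=> mF F0; apply: measurable_mean_action => [|z].
  apply: emeasurable_funD; first exact: measurable_running.
  exact: measurable_mean_next.
by apply: adde_ge0; [exact: running_ge0|exact: mean_next_ge0].
Qed.

Lemma value_ge0 r rho j t x : 0 <= value r rho j t x.
Proof.
elim: j t x => [|j IH] t x /=; first exact: final_ge0.
exact: stage_value_ge0.
Qed.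

Lemma measurable_value r rho j t : measurable_fun [set: S] (value r rho j t).
Proof.
elim: j t => [|j IH] t /=; first exact: measurable_final.
by apply: measurable_stage_value => // y; exact: value_ge0.
Qed.

Lemma value_eq r rho rho' j t : (forall i, (t <= i)%N -> rho i = rho' i) ->
  value r rho j t = value r rho' j t.
Proof.
elim: j t => //= j IH t rr; rewrite rr// IH// => i ti.
by apply: rr; exact: ltnW.
Qed.

Lemma stage_reward_ge0 r pi s : 0 <= stage_reward r pi s.
Proof.
by apply: integral_ge0 => x _; apply: mean_action_ge0 => z; exact: running_ge0.
Qed.

Lemma hybrid_ge0 r pi rho s : 0 <= hybrid r pi rho s.
Proof.
apply: adde_ge0; first by apply: sume_ge0 => i _; exact: stage_reward_ge0.
by apply: integral_ge0 => x _; exact: value_ge0.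
Qed.

(** One unfolding of [value] gives [hybrid] at [s] the same shape as at [s.+1] in [hybridS]: only
    the kernel used at time [s] differs. *)
Lemma hybrid_stage r pi rho s : (s < T)%N ->
  hybrid r pi rho s = \sum_(i < s) stage_reward r pi i +
    \int[law Y pi s]_x stage_value r (rho s) s (value r rho (T - s.+1) s.+1) x.
Proof. by move=> sT; rewrite /hybrid -subnSK. Qed.

Lemma hybridS r pi rho s :
  hybrid r pi rho s.+1 = \sum_(i < s) stage_reward r pi i +
    \int[law Y pi s]_x stage_value r (pi s) s (value r rho (T - s.+1) s.+1) x.
Proof.
set V := value r rho (T - s.+1) s.+1.
have V0 x : 0 <= V x by exact: value_ge0.
have mV : measurable_fun [set: S] V by exact: measurable_value.
have N0 z : 0 <= mean_next Y s V z by exact: mean_next_ge0.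
have mN : measurable_fun [set: S * A] (mean_next Y s V).
  exact: measurable_mean_next.
have mr := measurable_running r s; have r0 := running_ge0 r s.
rewrite /hybrid big_ord_recr/= -addeA; congr (_ + _).
rewrite integral_lawS// /stage_reward -ge0_integralD//; last 4 first.
- by move=> x _; exact: mean_action_ge0.
- exact: measurable_mean_action.
- by move=> x _; exact: mean_action_ge0.
- exact: measurable_mean_action.
apply: eq_integral => x _; rewrite /stage_value /mean_action ge0_integralD//.
- by apply: (measurableT_comp mr); exact: measurable_pair1.
- by apply: (measurableT_comp mN); exact: measurable_pair1.
Qed.

Lemma hybridT r pi rho : hybrid r pi rho T = total_reward r pi.
Proof. by rewrite /hybrid subnn. Qed.

Lemma hybrid_self r pi s : (s <= T)%N -> hybrid r pi pi s = total_reward r pi.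
Proof.
suff H j : forall u, (u + j)%N = T -> hybrid r pi pi u = total_reward r pi.
  by move=> sT; apply: (H (T - s)%N); exact: subnKC.
elim: j => [|j IH] u; first by rewrite addn0 => ->; exact: hybridT.
rewrite addnS -addSn => uT; rewrite -(IH _ uT) hybridS hybrid_stage//.
by rewrite -uT leq_addr.
Qed.

(** Laws depend on earlier kernels only, values on current and later ones only. A hybrid is thus the
    total reward of an actual policy, which is how finiteness reaches it. *)
Lemma hybrid_switch r pi rho s : (s <= T)%N ->
  hybrid r pi rho s =
  total_reward r (fun i => if (i < s)%N then pi i else rho i).
Proof.
move=> sT; set sw := fun i => _; rewrite -(hybrid_self r sw s sT) /hybrid.
have pisw i : (i < s)%N -> pi i = sw i by rewrite /sw => ->.
congr (_ + _).
  apply: eq_bigr => i _; rewrite /stage_reward pisw// (law_eq pi sw)// => j ji.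
  by apply: pisw; exact: ltn_trans ji _.
rewrite (law_eq pi sw)// (value_eq r rho sw)// => i si.
by rewrite /sw ltnNge si.
Qed.

Section compare.
Variables p q : nonneg_rewards.
(** This is [J] when [p] and [q] are the positive and negative parts of integrable rewards; [fine]
    is harmless there because both totals are finite. *)
Definition balance pi : R :=
  (fine (total_reward p pi) - fine (total_reward q pi))%R.

(* Following pi rather than rho at time s, before following rho, does not
   increase the expected balance of p over q. *)
Definition stage_le (k : R.-pker S ~> A) rho s x : bool :=
  stage_value p k s (value p rho (T - s.+1) s.+1) x +
    stage_value q (rho s) s (value q rho (T - s.+1) s.+1) x <=
  stage_value p (rho s) s (value p rho (T - s.+1) s.+1) x +
    stage_value q k s (value q rho (T - s.+1) s.+1) x.

Lemma hybrid_fin_num r pi rho s : (forall pi', total_reward r pi' < +oo) ->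
  (s <= T)%N -> hybrid r pi rho s \is a fin_num.
Proof.
by move=> rfin sT; rewrite ge0_fin_numE ?hybrid_ge0// hybrid_switch.
Qed.

(** It runs from [balance rho] at [s = 0] to [balance pi] at [s = T]; its increments are the terms
    of the performance difference formula. *)
Let gap pi rho s : R :=
  (fine (hybrid p pi rho s) - fine (hybrid q pi rho s))%R.

Hypothesis total_p : forall pi, total_reward p pi < +oo.
Hypothesis total_q : forall pi, total_reward q pi < +oo.

Let gap0 pi rho : gap pi rho 0%N = balance rho.
Proof. by rewrite /gap /balance !hybrid_switch. Qed.

Let gapT pi rho : gap pi rho T = balance pi.
Proof. by rewrite /gap /balance !hybridT. Qed.

Let V r rho s := value r rho (T - s.+1) s.+1.

Let Q r k rho s := stage_value r k s (V r rho s).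

Let Q0 r k rho s x : 0 <= Q r k rho s x.
Proof. by apply: stage_value_ge0 => y; exact: value_ge0. Qed.

Let mQ r k rho s : measurable_fun [set: S] (Q r k rho s).
Proof.
by apply: measurable_stage_value; [exact: measurable_value|
  move=> y; exact: value_ge0].
Qed.

Let stage_integrals pi rho s : (s < T)%N ->
  let I r k := \int[law Y pi s]_x Q r k rho s x in
  [/\ I p (pi s) \is a fin_num, I q (pi s) \is a fin_num,
    I p (rho s) \is a fin_num, I q (rho s) \is a fin_num &
    (gap pi rho s.+1 - gap pi rho s =
      fine (I p (pi s)) + fine (I q (rho s)) -
       (fine (I p (rho s)) + fine (I q (pi s))))%R].
Proof.
move=> sT I.
have Ifin r : (forall pi', total_reward r pi' < +oo) ->
    [/\ I r (pi s) \is a fin_num, I r (rho s) \is a fin_num &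
      (fine (hybrid r pi rho s.+1) - fine (hybrid r pi rho s) =
       fine (I r (pi s)) - fine (I r (rho s)))%R].
  move=> rfin.
  have := hybrid_fin_num r pi rho s.+1 rfin sT.
  have := hybrid_fin_num r pi rho s rfin (ltnW sT).
  rewrite hybridS hybrid_stage// -/(V r rho s) -/(Q r (pi s) rho s)
    -/(Q r (rho s) rho s) -/(I r (pi s)) -/(I r (rho s)).
  (* [c] is the reward collected before time [s]; it is common to both hybrids and finite, so it
     cancels. *)
  move: (\sum_(i < s) _) (I r (pi s)) (I r (rho s)) => c i j.
  rewrite !fin_numD => /andP[cfin jfin] /andP[_ ifin]; split => //.
  by rewrite (fineD cfin ifin) (fineD cfin jfin) opprD addrACA subrr add0r.
have [Ip1 Ip2 Ep] := Ifin p total_p; have [Iq1 Iq2 Eq] := Ifin q total_q.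
split => //; rewrite /gap.
transitivity ((fine (hybrid p pi rho s.+1) - fine (hybrid p pi rho s)) -
  (fine (hybrid q pi rho s.+1) - fine (hybrid q pi rho s)))%R; first by ring.
have rearrange (a b c e : R) : (a - b - (c - e) = a + e - (b + c))%R by ring.
by rewrite Ep Eq; exact: rearrange.
Qed.

Let gap_le pi rho s : (s < T)%N ->
  {ae law Y pi s, forall x, stage_le (pi s) rho s x} ->
  (gap pi rho s.+1 <= gap pi rho s)%R /\
  ((gap pi rho s <= gap pi rho s.+1)%R ->
   {ae law Y pi s, forall x, Q p (rho s) rho s x + Q q (pi s) rho s x <=
     Q p (pi s) rho s x + Q q (rho s) rho s x}).
Proof.
move=> sT le_ae; have [Ip1 Iq1 Ip2 Iq2 gapE] := stage_integrals pi rho s sT.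
have [le_int ge_int] := ae_le_integralD2 (law Y pi s) _ _ _ _
  (mQ p (pi s) rho s) (mQ q (rho s) rho s) (mQ p (rho s) rho s)
  (mQ q (pi s) rho s) (Q0 p (pi s) rho s) (Q0 q (rho s) rho s)
  (Q0 p (rho s) rho s) (Q0 q (pi s) rho s) Ip1 Iq2 Ip2 Iq1 le_ae.
split; first by rewrite -subr_le0 gapE subr_le0.
by rewrite -subr_ge0 gapE subr_ge0.
Qed.

(** The increments of [gap] telescope, and each is at most zero. *)
Lemma balance_le pi rho : (forall s, (s < T)%N ->
    {ae law Y pi s, forall x, stage_le (pi s) rho s x}) ->
  (balance pi <= balance rho)%R.
Proof.
move=> le_ae; rewrite -(gap0 pi rho) -(gapT pi rho).
elim: {-2}T (leqnn T) => // s IH sT.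
apply: (le_trans _ (IH (ltnW sT))).
by have [] := gap_le pi rho s sT (le_ae s sT).
Qed.

(** The increments of [gap] are at most zero and here their sum is at least zero, so each is zero
    and the equality case applies at every stage. *)
Lemma balance_ge_stage pi rho : (forall s, (s < T)%N ->
    {ae law Y pi s, forall x, stage_le (pi s) rho s x}) ->
  (balance rho <= balance pi)%R -> forall s, (s < T)%N ->
  {ae law Y pi s, forall x,
    stage_value p (rho s) s (value p rho (T - s.+1) s.+1) x +
      stage_value q (pi s) s (value q rho (T - s.+1) s.+1) x <=
    stage_value p (pi s) s (value p rho (T - s.+1) s.+1) x +
      stage_value q (rho s) s (value q rho (T - s.+1) s.+1) x}.
Proof.
move=> le_ae; rewrite -(gap0 pi rho) -(gapT pi rho) => gap0T s sT.
have [_ ] := gap_le pi rho s sT (le_ae s sT); apply.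
have gap_anti i j : (i + j <= T)%N -> (gap pi rho (i + j)%N <= gap pi rho i)%R.
  elim: j => [|j IH] ijT; first by rewrite addn0.
  rewrite addnS in ijT *; apply: le_trans (IH (ltnW ijT)).
  by have [] := gap_le pi rho (i + j)%N ijT (le_ae _ ijT).
have := gap_anti 0%N s (ltnW sT); rewrite add0n => /le_trans; apply.
apply: le_trans gap0T _; rewrite -{1}(subnKC sT); apply: gap_anti.
by rewrite subnKC.
Qed.

End compare.

End values.

(** * Optimality in the original system *)

Section objective_balance.
Local Open Scope ereal_scope.
Context {R : realType}.

(** Each reward is split on its own, rather than their sum, so that [p] and [q] are again sums over
    stages. *)
Lemma integral_sum_balance {d} {X : measurableType d}
    (mu : {measure set X -> \bar R}) (T : nat) (f : 'I_T -> X -> R) (h : X -> R) :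
  (forall t, mu.-integrable setT (fun x => (f t x)%:E)) ->
  mu.-integrable setT (fun x => (h x)%:E) ->
  let pos y := maxe y%:E 0 in
  let neg y := maxe (- y%:E) 0 in
  let p := \sum_(t < T) \int[mu]_x pos (f t x) + \int[mu]_x pos (h x) in
  let q := \sum_(t < T) \int[mu]_x neg (f t x) + \int[mu]_x neg (h x) in
  [/\ p < +oo, q < +oo &
    \int[mu]_x (\sum_(t < T) f t x + h x)%:E = (fine p - fine q)%:E].
Proof.
move=> intf inth pos neg p q.
have posP (k : X -> R) : \int[mu]_x pos (k x) = \int[mu]_x (EFin \o k)^\+ x.
  by apply: eq_integral => x _; rewrite funeposE.
have negP (k : X -> R) : \int[mu]_x neg (k x) = \int[mu]_x (EFin \o k)^\- x.
  by apply: eq_integral => x _; rewrite funenegE.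
have posE (k : X -> R) : mu.-integrable setT (fun x => (k x)%:E) ->
    \int[mu]_x pos (k x) = (fine (\int[mu]_x pos (k x)))%:E.
  move=> ik; rewrite posP fineK// ge0_fin_numE ?integral_ge0//.
  exact: integral_funepos_lt_pinfty.
have negE (k : X -> R) : mu.-integrable setT (fun x => (k x)%:E) ->
    \int[mu]_x neg (k x) = (fine (\int[mu]_x neg (k x)))%:E.
  move=> ik; rewrite negP fineK// ge0_fin_numE ?integral_ge0//.
  exact: integral_funeneg_lt_pinfty.
have intE (k : X -> R) : mu.-integrable setT (fun x => (k x)%:E) ->
    \int[mu]_x (k x)%:E =
      (fine (\int[mu]_x pos (k x)) - fine (\int[mu]_x neg (k x)))%:E.
  by move=> ik; rewrite integralE -posP -negP posE// negE.
have pE : p = (\sum_(t < T) fine (\int[mu]_x pos (f t x)) +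
    fine (\int[mu]_x pos (h x)))%:E.
  by rewrite /p EFinD -sumEFin -posE//; congr (_ + _); apply: eq_bigr => t _;
    exact: posE.
have qE : q = (\sum_(t < T) fine (\int[mu]_x neg (f t x)) +
    fine (\int[mu]_x neg (h x)))%:E.
  by rewrite /q EFinD -sumEFin -negE//; congr (_ + _); apply: eq_bigr => t _;
    exact: negE.
split; [by rewrite pE ltry|by rewrite qE ltry|].
rewrite pE qE/= opprD addrACA -sumrB.
under eq_integral do rewrite EFinD -sumEFin.
rewrite integralD//; last exact: integrable_sum.
rewrite integral_sum// EFinD -sumEFin; congr (_ + _).
  by apply: eq_bigr => t _; exact: intE.
exact: intE.
Qed.

Context {dS dA dW : measure_display} {S : measurableType dS}
  {A : measurableType dA} {W : measurableType dW}.
Variables (Y : @system R _ _ _ S A W) (T : nat).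
Variables (g : nat -> S * A -> R) (gT : S -> R).
Hypothesis mg : forall t, measurable_fun [set: S * A] (g t).
Hypothesis mgT : measurable_fun [set: S] gT.

Let pos (y : R) := maxe y%:E 0.
Let neg (y : R) := maxe (- y%:E) 0.

Let mpos d (X : measurableType d) (f : X -> R) : measurable_fun [set: X] f ->
  measurable_fun [set: X] (fun x => pos (f x)).
Proof. by move=> mf; apply: measurable_maxe => //; exact/measurable_EFinP. Qed.

Let mneg d (X : measurableType d) (f : X -> R) : measurable_fun [set: X] f ->
  measurable_fun [set: X] (fun x => neg (f x)).
Proof.
move=> mf; apply: measurable_maxe => //; apply: measurableT_comp => //.
exact/measurable_EFinP.
Qed.

Let pos_ge0 y : 0 <= pos y. Proof. by rewrite le_max lexx orbT. Qed.
Let neg_ge0 y : 0 <= neg y. Proof. by rewrite le_max lexx orbT. Qed.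

Definition positive_rewards : nonneg_rewards := NonnegRewards
  (fun t z => pos (g t z)) (fun x => pos (gT x))
  (fun t => mpos _ _ _ (mg t)) (mpos _ _ _ mgT)
  (fun t z => pos_ge0 (g t z)) (fun x => pos_ge0 (gT x)).

Definition negative_rewards : nonneg_rewards := NonnegRewards
  (fun t z => neg (g t z)) (fun x => neg (gT x))
  (fun t => mneg _ _ _ (mg t)) (mneg _ _ _ mgT)
  (fun t z => neg_ge0 (g t z)) (fun x => neg_ge0 (gT x)).

Lemma total_trajectory r pi : total_reward Y T r pi =
  \sum_(t < T) \int[trajectory Y pi T]_h running r t (tnth h.1 t) +
  \int[trajectory Y pi T]_h final r h.2.
Proof.
rewrite /total_reward integral_law; last 2 first.
- exact: measurable_final.
- exact: final_ge0.
congr (_ + _); apply: eq_bigr => t _; rewrite integral_trajectory_step//.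
- exact: measurable_running.
- exact: running_ge0.
Qed.

Lemma J_balance pi : integrable_rewards Y T g gT pi ->
  [/\ total_reward Y T positive_rewards pi < +oo,
    total_reward Y T negative_rewards pi < +oo &
    J Y T g gT pi =
      (balance Y T positive_rewards negative_rewards pi)%:E].
Proof.
move=> [intg intgT].
have [pfin qfin E] := @integral_sum_balance _ _ (trajectory Y pi T) T
  (fun t h => g t (tnth h.1 t)) (fun h => gT h.2) intg intgT.
rewrite /J /balance !total_trajectory expectation.unlock; split;
  [exact: pfin|exact: qfin|exact: E].
Qed.

End objective_balance.

(** * One-stage deviations from the unique optimal policy *)

Section one_stage_deviation.
Local Open Scope ereal_scope.
Context {R : realType} {dS dA dW : measure_display} {S : measurableType dS}
  {A : measurableType dA} {W : measurableType dW}.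
Variables (Y : @system R _ _ _ S A W) (T : nat).
Implicit Types (k : R.-pker S ~> A) (r p q : @nonneg_rewards R _ _ S A).
Implicit Types (pi rho : @policy R _ _ S A).

Lemma stage_value_eq r k k' t F x : k x ≡μ k' x ->
  stage_value Y r k t F x = stage_value Y r k' t F x.
Proof. by move=> kk'; apply: eq_measure_integral => B mB _; exact: kk'. Qed.

Lemma measurable_stage_le p q k rho t :
  measurable_fun [set: S] (stage_le Y T p q k rho t).
Proof.
by apply: measurable_fun_lee; apply: emeasurable_funD;
  apply: measurable_stage_value => [|x];
  by [exact: measurable_value|exact: value_ge0].
Qed.

Lemma stage_le_equiv p q k rho t x : k x ≡μ rho t x ->
  stage_le Y T p q k rho t x.
Proof. by move=> kr; rewrite /stage_le !(stage_value_eq _ k (rho t))// lexx. Qed.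

Lemma stage_le_total p q k rho t x :
  stage_le Y T p q k rho t x || stage_le Y T q p k rho t x.
Proof.
rewrite /stage_le [X in _ || (X <= _)]addeC [X in _ || (_ <= X)]addeC.
exact: le_total.
Qed.

Lemma balanceN p q pi : balance Y T q p pi = (- balance Y T p q pi)%R.
Proof. by rewrite /balance opprB. Qed.

Variables (g : nat -> S * A -> R) (gT : S -> R).
Hypothesis mg : forall t, measurable_fun [set: S * A] (g t).
Hypothesis mgT : measurable_fun [set: S] gT.
Hypothesis intg : forall pi, integrable_rewards Y T g gT pi.

Let p := positive_rewards g gT mg mgT.
Let q := negative_rewards g gT mg mgT.

Lemma J_le pi rho : (J Y T g gT pi <= J Y T g gT rho) =
  (balance Y T p q pi <= balance Y T p q rho)%R.
Proof.
have [_ _ ->] := J_balance Y T g gT mg mgT pi (intg pi).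
have [_ _ ->] := J_balance Y T g gT mg mgT rho (intg rho).
by rewrite lee_fin.
Qed.

(* Where k does at least as well as rho at time t, one may follow k instead of
   rho at time t without losing optimality, so uniqueness forces k = rho there. *)
Lemma unique_optimal_stage rho k t :
  unique_optimal Y T g gT (fun=> True) rho -> (t < T)%N ->
  holds_where_reachable Y t
    (fun x => stage_le Y T q p k rho t x -> k x ≡μ rho t x).
Proof.
move=> [[_ rho_opt] rho_uniq] tT pi.
(* With [p] and [q] exchanged, [stage_le] says that [k] does at least as well as [rho]; [dev] uses
   [k] exactly there. *)
pose b := stage_le Y T q p k rho t.
pose dev : R.-pker S ~> A := kif b k (rho t) (measurable_stage_le q p k rho t).
pose rho' i := if i == t then dev else rho i.
have rho'_opt : optimal Y T g gT (fun=> True) rho'.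
  split=> // pi' _; apply: le_trans (rho_opt pi' Logic.I) _.
  (* Exchanging [p] and [q] negates the balance, so the desired lower bound for [rho'] becomes an
     upper bound of the kind [balance_le] gives. *)
  rewrite J_le -lerN2 -!balanceN; apply: balance_le => [pi''|pi''|s sT].
  - have [_ qfin _] := J_balance Y T g gT mg mgT pi'' (intg pi'').
    exact: qfin.
  - have [pfin _ _] := J_balance Y T g gT mg mgT pi'' (intg pi'').
    exact: pfin.
  apply: aeW => x; rewrite /rho'; case: eqP => [->|_]; last exact: stage_le_equiv.
  have [bx|bx] := boolP (b x); last first.
    by apply: stage_le_equiv => B mB; rewrite /= /kif (negbTE bx).
  move: (bx); rewrite /b /stage_le.
  have kE r F : stage_value Y r dev t F x = stage_value Y r k t F x.
    by apply: stage_value_eq => B mB; rewrite /= /kif bx.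
  by rewrite !kE.
have rho'_ae : {ae law Y pi t, forall x, rho' t x ≡μ rho t x}.
  exact: rho_uniq.
suff : {ae law Y pi t, forall x, b x -> k x ≡μ rho t x} by [].
apply: filterS rho'_ae => x + bx.
by rewrite /rho' eqxx => + B mB => /(_ B mB); rewrite /= /kif bx.
Qed.

End one_stage_deviation.

(** * The augmented system *)

Section alarm_flag.
Local Open Scope ereal_scope.
Context {R : realType} {dX dA dW : measure_display} {X : measurableType dX}
  {A : measurableType dA} {W : measurableType dW}.
Variables (Y : @system R _ _ _ X A W) (Xa : set X) (mXa : measurable Xa).
Local Notation Yhat := (augmented Y mXa).

Let measurable_flag (b : bool) : measurable_fun [set: X] (fun x : X => (x, b)).
Proof. exact: measurable_pair2. Qed.

Let at_flag (b : bool) (k : R.-pker (X * bool)%type ~> A) : R.-pker X ~> A :=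
  kreindex (fun x => (x, b)) k (measurable_flag b).

(** Whatever the flag, the kernel in force has weight one half in the mixture [pi], so each step
    loses a factor of at most 2 on integrands that ignore the flag. *)
Lemma integral_law_augmented_le (pihat : policy (X * bool)%type A) :
  exists pi : policy X A, forall t (F : X -> \bar R),
  measurable_fun [set: X] F -> (forall x, 0 <= F x) ->
  \int[law Yhat pihat t]_z F z.1 <= (2 ^+ t)%:E * \int[law Y pi t]_x F x.
Proof.
pose pi : policy X A := fun t =>
  kmix (at_flag true (pihat t)) (at_flag false (pihat t)).
exists pi; elim=> [|t IH] F mF F0.
  rewrite expr0 mul1e !integral_law0//; last exact: measurableT_comp.
  by rewrite ge0_integral_distribution//; exact: measurableT_comp.
have mF1 : measurable_fun [set: X * bool] (fun z => F z.1).
  exact: measurableT_comp.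
rewrite integral_lawS// integral_lawS//.
pose G z := mean_next Y t F z.
have mG : measurable_fun [set: X * A] G by exact: measurable_mean_next.
have G0 z : 0 <= G z by exact: mean_next_ge0.
pose H x := mean_action (pi t) G x.
have mH : measurable_fun [set: X] H by exact: measurable_mean_action.
have H0 x : 0 <= H x by exact: mean_action_ge0.
have GE z : mean_next Yhat t (fun z => F z.1) z = G (z.1.1, z.2).
  by case: z => -[x b] a.
have step z : mean_action (pihat t) (mean_next Yhat t (fun z => F z.1)) z <=
    2%:E * H z.1.
  have mGx : measurable_fun [set: A] (fun a => G (z.1, a)).
    by apply: (measurableT_comp mG); exact: measurable_pair1.
  rewrite /H /mean_action ge0_integral_kmix// muleA -EFinM divff// mul1e.
  case: z mGx => x b /= mGx.
  rewrite [leLHS](_ : _ = \int[at_flag b (pihat t) x]_a G (x, a)); last first.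
    by apply: eq_integral => a _; rewrite GE.
  (* The kernel of the other flag only adds a nonnegative term. *)
  clear mGx; case: b; [rewrite leeDl//|rewrite leeDr//]; exact: integral_ge0.
rewrite exprSr EFinM -muleA -ge0_integralZl//.
apply: le_trans (IH (fun x => 2%:E * H x) _ _); last 2 first.
- exact: measurable_funeM.
- by move=> x; rewrite mule_ge0.
apply: ge0_le_integral => //.
- by move=> z _; apply: mean_action_ge0 => u; exact: mean_next_ge0.
- apply: measurable_mean_action; last by move=> u; exact: mean_next_ge0.
  exact: measurable_mean_next.
- apply: (@measurableT_comp _ _ _ _ _ _ (fun x => 2%:E * H x)) => //.
  exact: measurable_funeM.
Qed.

(** The bound on integrals is applied to the indicator of a null set [N] that contains the failures
    of [P]. *)
Lemma holds_where_reachable_augmented t (P : X -> Prop) :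
  holds_where_reachable Y t P ->
  holds_where_reachable Yhat t (fun z => P z.1).
Proof.
move=> Pae pihat; have [pi le_pi] := integral_law_augmented_le pihat.
have [N [mN N0 PN]] : {ae law Y pi t, forall x, P x} by exact: Pae.
suff : {ae law Yhat pihat t, forall z, P z.1} by [].
have mfN : measurable (fst @^-1` N : set (X * bool)).
  by rewrite -[X in measurable X]setTI; exact: measurable_fst.
exists (fst @^-1` N); split => //; last by move=> z; exact: PN.
have mN1 : measurable_fun [set: X] (fun x => (\1_N x)%:E : \bar R).
  by apply/measurable_EFinP; exact: measurable_indic.
have lawN : \int[law Y pi t]_x (\1_N x)%:E = 0.
  by rewrite integral_indic// setIT; exact: N0.
have lawfN : \int[law Yhat pihat t]_z (\1_N z.1)%:E =
    law Yhat pihat t (fst @^-1` N).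
  by rewrite -[in RHS](setIT (fst @^-1` N)) -integral_indic.
have le0 : law Yhat pihat t (fst @^-1` N) <= 0.
  rewrite -lawfN; apply: le_trans (le_pi t _ mN1 _) _ => //.
  by rewrite lawN mule0.
by apply/eqP; rewrite -measure_le0; exact: le0.
Qed.

(** * Alarm probability and the kernels at unflagged states *)

Section same_before_alarm.
Variables pihat pihat' : nat -> R.-pker (X * bool)%type ~> A.
Hypothesis same : forall t x, pihat t (x, false) ≡μ pihat' t (x, false).

(** The flag is absorbing, so an unflagged state has an unflagged past. In the induction, integrands
    that vanish at flagged states are preserved by the backward step, and elsewhere the kernels
    agree. *)
Lemma integral_law_unflagged t (F : X * bool -> \bar R) :
  measurable_fun [set: X * bool] F -> (forall z, 0 <= F z) ->
  (forall x, F (x, true) = 0) ->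
  \int[law Yhat pihat t]_z F z = \int[law Yhat pihat' t]_z F z.
Proof.
elim: t F => [|t IH] F mF F0 Ftrue; first by rewrite !integral_law0.
have Gtrue x a : mean_next Yhat t F ((x, true), a) = 0.
  by apply: integral0_eq => w _; rewrite /= orbT.
have mG : measurable_fun [set: X * bool * A] (mean_next Yhat t F).
  exact: measurable_mean_next.
have G0 z : 0 <= mean_next Yhat t F z by exact: mean_next_ge0.
have Htrue pi x : mean_action (pi t) (mean_next Yhat t F) (x, true) = 0.
  by apply: integral0_eq => a _; exact: Gtrue.
rewrite !integral_lawS// IH//; last 2 first.
- exact: measurable_mean_action.
- by move=> z; exact: mean_action_ge0.
apply: eq_integral => -[x []] _; first by rewrite !Htrue.
by apply: eq_measure_integral => B mB _; exact: same.
Qed.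

Lemma alarm_probability_eq T :
  alarm_probability Y mXa T pihat = alarm_probability Y mXa T pihat'.
Proof.
pose N := [set z : X * bool | z.2 = true].
have mN : measurable N.
  rewrite (_ : N = setT `&` snd @^-1` [set true]); first exact: measurable_snd.
  by rewrite setTI.
have alarmE pi : alarm_probability Y mXa T pi =
    1 - \int[law Yhat pi T]_z (\1_(~` N) z)%:E.
  have -> : \int[law Yhat pi T]_z (\1_(~` N) z)%:E = law Yhat pi T (~` N).
    by rewrite -[in RHS](setIT (~` N)) -integral_indic//; exact: measurableC.
  have := probability_setC (law Yhat pi T) (measurableC mN).
  by rewrite setCK.
rewrite !alarmE integral_law_unflagged//.
- by apply/measurable_EFinP; apply: measurable_indic; exact: measurableC.
- by move=> x; rewrite indicE memNset//=; apply.
Qed.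

End same_before_alarm.

Definition flag_blind (r : @nonneg_rewards R _ _ X A)
    (rhat : @nonneg_rewards R _ _ (X * bool)%type A) : Prop :=
  (forall t x b a, running rhat t ((x, b), a) = running r t (x, a)) /\
  (forall x b, final rhat (x, b) = final r x).

(** * Agreement of values at flagged states with those of the original system *)

Section flagged_values.
Variables (r : @nonneg_rewards R _ _ X A)
  (rhat : @nonneg_rewards R _ _ (X * bool)%type A).
Hypothesis blind : flag_blind r rhat.

(** From a flagged state the flag stays at 1, so the augmented system moves as a copy of the
    original one. *)
Lemma stage_value_flagged (khat : R.-pker (X * bool)%type ~> A)
    (k : R.-pker X ~> A) t (Fhat : X * bool -> \bar R) (F : X -> \bar R) x :
  khat (x, true) ≡μ k x ->
  (forall y, Fhat (y, true) = F y) ->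
  stage_value Yhat rhat khat t Fhat (x, true) = stage_value Y r k t F x.
Proof.
move=> kE FE; rewrite /stage_value /mean_action.
rewrite (eq_measure_integral (k x)); last by move=> B mB _; exact: kE.
apply: eq_integral => a _; rewrite blind.1; congr (_ + _).
by apply: eq_integral => w _; rewrite /= orbT FE.
Qed.

Variables (pihat : nat -> R.-pker (X * bool)%type ~> A)
  (pi : nat -> R.-pker X ~> A).
Hypothesis piE : forall s y, pihat s (y, true) ≡μ pi s y.

Lemma value_flagged j t x :
  value Yhat rhat pihat j t (x, true) = value Y r pi j t x.
Proof.
elim: j t x => [|j IH] t x /=; first exact: blind.2.
exact: stage_value_flagged.
Qed.

Lemma continuation_flagged (khat : R.-pker (X * bool)%type ~> A)
    (k : R.-pker X ~> A) t j x : khat (x, true) ≡μ k x ->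
  stage_value Yhat rhat khat t (value Yhat rhat pihat j t.+1) (x, true) =
  stage_value Y r k t (value Y r pi j t.+1) x.
Proof.
by move=> kE; apply: stage_value_flagged => // y; exact: value_flagged.
Qed.

End flagged_values.

Lemma stage_le_flagged T (p q : @nonneg_rewards R _ _ X A)
    (phat qhat : @nonneg_rewards R _ _ (X * bool)%type A)
    (khat : R.-pker (X * bool)%type ~> A) (k : R.-pker X ~> A)
    (pihat : nat -> R.-pker (X * bool)%type ~> A) (pi : nat -> R.-pker X ~> A)
    t x :
  flag_blind p phat -> flag_blind q qhat -> khat (x, true) ≡μ k x ->
  (forall s y, pihat s (y, true) ≡μ pi s y) ->
  stage_le Yhat T phat qhat khat pihat t (x, true) =
  stage_le Y T p q k pi t x.
Proof.
move=> pp qq kE piE; have tE := piE t x; rewrite /stage_le.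
rewrite (continuation_flagged p phat pp pihat pi piE khat k)//.
rewrite (continuation_flagged p phat pp pihat pi piE (pihat t) (pi t))//.
rewrite (continuation_flagged q qhat qq pihat pi piE khat k)//.
by rewrite (continuation_flagged q qhat qq pihat pi piE (pihat t) (pi t)).
Qed.

(** * The constrained optimum against its modification after the alarm *)

Section comparison.
Variables (T : nat) (g : nat -> X * A -> R) (gT : X -> R).
Hypothesis mg : forall t, measurable_fun [set: X * A] (g t).
Hypothesis mgT : measurable_fun [set: X] gT.

Let ghat t (z : X * bool * A) := g t (z.1.1, z.2).
Let gThat (z : X * bool) := gT z.1.

Let mghat t : measurable_fun [set: X * bool * A] (ghat t).
Proof.
apply: (measurableT_comp (mg t)); apply: measurable_fun_pair => //.
exact: measurableT_comp.
Qed.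

Let mgThat : measurable_fun [set: X * bool] gThat.
Proof. exact: measurableT_comp. Qed.

Hypothesis intg : forall pi, integrable_rewards Y T g gT pi.
Hypothesis intghat : forall pihat, integrable_rewards Yhat T ghat gThat pihat.

Let p := positive_rewards g gT mg mgT.
Let q := negative_rewards g gT mg mgT.
Let phat := positive_rewards ghat gThat mghat mgThat.
Let qhat := negative_rewards ghat gThat mghat mgThat.

Let total_phat pi : total_reward Yhat T phat pi < +oo.
Proof.
by have [pfin _ _] := J_balance Yhat T ghat gThat mghat mgThat pi (intghat pi).
Qed.

Let total_qhat pi : total_reward Yhat T qhat pi < +oo.
Proof.
by have [_ qfin _] := J_balance Yhat T ghat gThat mghat mgThat pi (intghat pi).
Qed.

Section after_alarm_policy.
Variables (piu : nat -> R.-pker X ~> A)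
  (pihat : nat -> R.-pker (X * bool)%type ~> A).

Let measurable_no_flag : measurable_fun [set: X * bool] (fst : X * bool -> X).
Proof. exact: measurable_fst. Qed.

Let measurable_is_flagged :
  measurable_fun [set: X * bool] (snd : X * bool -> bool).
Proof. exact: measurable_snd. Qed.

Definition after_alarm t : R.-pker (X * bool)%type ~> A :=
  kif snd (kreindex fst (piu t) measurable_no_flag) (pihat t)
    measurable_is_flagged.

(** The kernels of [pihat] after the alarm, as a policy of the original system that competes with
    [piu]. *)
Let flag_on t : R.-pker X ~> A := at_flag true (pihat t).

Let after_alarm_false t x : pihat t (x, false) ≡μ after_alarm t (x, false).
Proof. by []. Qed.

Lemma alarm_probability_after_alarm :
  alarm_probability Y mXa T after_alarm = alarm_probability Y mXa T pihat.
Proof. by rewrite (alarm_probability_eq pihat after_alarm). Qed.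

Hypothesis piu_opt : unique_optimal Y T g gT (fun=> True) piu.

Let flagged_ae t : (t < T)%N -> holds_where_reachable Yhat t (fun z =>
  stage_le Y T q p (flag_on t) piu t z.1 -> flag_on t z.1 ≡μ piu t z.1).
Proof.
move=> tT; apply: (holds_where_reachable_augmented t
  (fun x => stage_le Y T q p (flag_on t) piu t x -> flag_on t x ≡μ piu t x)).
exact: unique_optimal_stage.
Qed.

Let after_alarm_stage t : (t < T)%N -> {ae law Yhat pihat t, forall z,
  stage_le Yhat T phat qhat (pihat t) after_alarm t z}.
Proof.
move=> tT; have flagged : {ae law Yhat pihat t, forall z,
    stage_le Y T q p (flag_on t) piu t z.1 -> flag_on t z.1 ≡μ piu t z.1}.
  exact: flagged_ae.
apply: filterS flagged => -[x []] /= agree; last first.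
  by apply: stage_le_equiv; exact: after_alarm_false.
rewrite (stage_le_flagged T p q phat qhat (pihat t) (flag_on t)
  after_alarm piu)//.
(* Either [pihat] does no better than [piu] at [x], as claimed, or it does at least as well, and
   then [agree] makes the kernels equal. *)
have /orP[//|/agree] := stage_le_total Y T p q (flag_on t) piu t x.
exact: stage_le_equiv.
Qed.

Lemma J_after_alarm :
  J Yhat T ghat gThat pihat <= J Yhat T ghat gThat after_alarm.
Proof.
rewrite (J_le _ _ _ _ mghat mgThat intghat).
exact: (balance_le _ _ _ _ total_phat total_qhat _ _ after_alarm_stage).
Qed.

(** Equality of the objectives makes the advantage of [piu] vanish at almost every flagged state;
    there [pihat] does at least as well as [piu], and uniqueness of [piu] gives equal kernels. *)
Lemma after_alarm_agree :
  J Yhat T ghat gThat after_alarm <= J Yhat T ghat gThat pihat ->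
  forall t, (t < T)%N -> {ae law Yhat pihat t, forall z,
    z.2 = true -> pihat t z ≡μ piu t z.1}.
Proof.
rewrite (J_le _ _ _ _ mghat mgThat intghat) => J_ge t tT.
have ge_ae : {ae law Yhat pihat t, forall z,
    stage_le Yhat T qhat phat (pihat t) after_alarm t z}.
  have := balance_ge_stage Yhat T phat qhat total_phat total_qhat pihat
    after_alarm after_alarm_stage J_ge t tT.
  apply: filterS => z ge_z; rewrite /stage_le addeC [leRHS]addeC; exact: ge_z.
have flagged : {ae law Yhat pihat t, forall z,
    stage_le Y T q p (flag_on t) piu t z.1 -> flag_on t z.1 ≡μ piu t z.1}.
  exact: flagged_ae.
apply: filterS2 ge_ae flagged => -[x []]//= ge_x agree _.
apply: agree; move: ge_x.
by rewrite (stage_le_flagged T q p qhat phat (pihat t) (flag_on t)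
  after_alarm piu).
Qed.

End after_alarm_policy.

End comparison.

End alarm_flag.

(** Kernels at states that carry no mass do not affect [J], so agreement is almost everywhere.
    Optimality alone gives it along the trajectories of [pihat]; uniqueness of [pihat] extends it to
    the states reached under any policy. *)
Theorem proposition1 (R : realType) (n m l : nat)
  (X : set (n.-tuple R)) (X0 : X !=set0)
  (A : set (m.-tuple R)) (A0 : A !=set0)
  (W : set (l.-tuple R)) (W0 : W !=set0)
  (Y : @system R _ _ _ (trace_space X0) (trace_space A0) (trace_space W0))
  (Xa : set (trace_space X0)) (mXa : measurable Xa)
  (T : nat)
  (g : nat -> {mfun (trace_space X0 * trace_space A0)%type >-> R})
  (gT : {mfun trace_space X0 >-> R})
  (Delta : R) (Delta_ge0 : 0 <= Delta) :
  let Yhat := augmented Y mXa in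
  let ghat := fun t (z : trace_space X0 * bool * trace_space A0) =>
    g t (z.1.1, z.2) in
  let gThat := fun z : trace_space X0 * bool => gT z.1 in
  let feasible := fun pihat => (alarm_probability Y mXa T pihat <= Delta%:E)%E in
  (forall pi, integrable_rewards Y T (fun t => g t) gT pi) ->
  (forall pihat, integrable_rewards Yhat T ghat gThat pihat) ->
  forall (piu : policy (trace_space X0) (trace_space A0))
    (pihat : policy (trace_space X0 * bool)%type (trace_space A0)),
  unique_optimal Y T (fun t => g t) gT (fun=> True) piu ->
  optimal Yhat T ghat gThat feasible pihat ->
  let agree_after_alarm := fun t (z : trace_space X0 * bool) =>
    z.2 = true -> pihat t z ≡μ piu t z.1 in
  (forall t, (t < T)%N ->
     {ae state_law Yhat pihat t, forall z, agree_after_alarm t z}) /\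
  (unique_optimal Yhat T ghat gThat feasible pihat ->
   forall t, (t < T)%N -> holds_where_reachable Yhat t (agree_after_alarm t)).
Proof.
move=> Yhat ghat gThat feasible intg intghat piu pihat piu_opt.
move=> [pihat_feasible pihat_opt] agree.
have mg t : measurable_fun setT (g t) by exact: measurable_funP.
have mgT : measurable_fun setT gT by exact: measurable_funP.
pose rho := after_alarm piu pihat.
have rho_feasible : feasible rho.
  rewrite /feasible (alarm_probability_after_alarm Y Xa mXa T piu pihat).
  exact: pihat_feasible.
have J_rho := J_after_alarm Y Xa mXa T (fun t => g t) gT mg mgT intg intghat
  piu pihat piu_opt.
split=> [|[_ pihat_uniq] t tT pi].
  exact: (after_alarm_agree Y Xa mXa T (fun t => g t) gT mg mgT intg intghat
    piu pihat piu_opt (pihat_opt rho rho_feasible)).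
(* [rho] is feasible and does at least as well as [pihat], so it is optimal too; uniqueness then
   identifies [pihat] with [rho], which follows [piu] at flagged states. *)
have rho_opt : optimal Yhat T ghat gThat feasible rho.
  split=> // pi' pi'_feasible; apply: le_trans J_rho.
  exact: pihat_opt.
have rho_ae : {ae law Yhat pi t, forall z, rho t z ≡μ pihat t z}.
  exact: pihat_uniq.
suff : {ae law Yhat pi t, forall z, agree t z} by [].
apply: filterS rho_ae => -[x []] same_x // _ B mB.
exact: esym (same_x B mB).
Qed.
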